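(* Let $\kappa > \frac{41}{83}$. Then there exists $p_0=p_0(\kappa)$ such that for every prime $p\ge p_0$ and every multiplicative subgroup $R\subseteq \mathbb{F}_p^*$ with $|R| \ge p^{\kappa}$ we have $\mathbb{F}^*_p \subseteq 6R$.
   Context: $6R=\{r_1+\dots+r_6: r_i\in R\}$ denotes the $6$-fold sumset of $R$. *)

(* Defs.v *)
From mathcomp Require Import all_boot all_order all_algebra all_fingroup.
From Stdlib Require Import Reals.
Set Implicit Arguments. Unset Strict Implicit. Unset Printing Implicit Defensive.
Import GRing.Theory.
Local Open Scope ring_scope.

Definition in_sumset (p h : nat) (R : {set {unit 'F_p}}) (x : 'F_p) : Prop :=
  exists r : 'I_h -> {unit 'F_p},
    (forall i, r i \in R) /\ x = \sum_(i < h) val (r i).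

(* Main.v *)
Require Import Defs.
From mathcomp Require Import all_boot all_order all_algebra all_fingroup all_field.
From mathcomp Require Import zify ring.
Set Implicit Arguments. Unset Strict Implicit. Unset Printing Implicit Defensive.
Import Order.TTheory GRing.Theory Num.Theory.

(** Write t = |R|, S = R + R, E for the additive energy of R and, for a pair
    c = (u, v), N(c) for the number of x <> 0, 1 with x^t = u and
    (x - 1)^t = v.

    Stepanov's method: a polynomial in X, X^t and (X - 1)^t that vanishes to
    high order at all x counted by N(c), c in a set of pairs, shows that N has
    weak-type decay, so that the sum of N^3 over the pairs with N large is at
    most t^2 log p up to a constant.

    Energy versus sumset: the value (R o R)(d) is N(d^-t, d^-t), and the pairs
    (y, z) in R^2 are sorted by the class of x = (1 + y) / (1 + z).  The number
    of pairs with a given x is again a value of N.  As 1 + y and 1 + z lie in S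
    while y - z carries the weight (R o R)(y - z), Hoelder's inequality gives
    E^3 <= C |S|^2 t^4 (log p)^3 (1 + t^2/p)^3.

    Fourier analysis: if lam is not in 6R then S + S + R + R misses lam R, so
    |S| t^3 <= p rho^3, where rho bounds the nontrivial Fourier coefficients of
    R.  These are constant on the orbits of R, hence t rho^4 <= p E.  With
    t^4 <= |S| E this yields t^71 <= p^35 up to logarithms when t^2 <= p, which
    is impossible for t >= p^(41/83) since 35/71 < 41/83. *)

Local Open Scope ring_scope.

(** * Stepanov's method *)

Section Lacunary.
Variables (F : fieldType) (p : nat).
Hypothesis small_neq0 : forall k, (0 < k < p)%N -> k%:R != 0 :> F.

Lemma natr_inj_small e c : (e < p)%N -> (c < p)%N -> e != c ->
  e%:R - c%:R != 0 :> F.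
Proof.
move=> ep cp; rewrite neq_ltn => /orP[lt|lt].
  by rewrite -opprB oppr_eq0 -natrB ?(ltnW lt)// small_neq0// subn_gt0 lt; lia.
by rewrite -natrB ?(ltnW lt)// small_neq0// subn_gt0 lt; lia.
Qed.

(* The operator [f |-> X f' - c f] removes the monomial X^c and lowers the
   multiplicity of the root 1 by at most one. *)
Lemma lacunary_coef0 (l : seq nat) (e : nat) (f : {poly F}) :
  uniq (e :: l) -> all (fun i => i < p)%N (e :: l) ->
  (forall i, f`_i != 0 -> i \in e :: l) ->
  ('X - 1) ^+ (size l).+1 %| f -> f`_e = 0.
Proof.
elim: l f => [|c l IH] f /= Hu Ha Hs Hd.
  have fE : f = f`_e *: 'X^e.
    apply/polyP => i; rewrite coefZ coefXn.
    have [->|ne] := eqVneq i e; first by rewrite mulr1.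
    rewrite mulr0; apply/eqP; apply: contraT => /Hs; rewrite inE => /eqP h.
    by rewrite h eqxx in ne.
  move: Hd; rewrite expr1 -polyC1 dvdp_XsubCl fE rootE hornerZ hornerXn expr1n.
  by rewrite mulr1 coefZ coefXn eqxx mulr1 => /eqP.
move: Hu; rewrite inE negb_or => /andP[/andP[nec el] /andP[cl ul]].
move: Ha => /and3P[ep cp al].
pose g := 'X * f^`() - c%:R *: f.
have gE i : g`_i = (i%:R - c%:R) * f`_i.
  rewrite /g coefB coefXM coefZ coef_deriv; case: i => [|i] /=.
    by rewrite mulrBl mul0r.
  by rewrite mulrBl (mulr_natl _ i.+1).
have : g`_e = 0.
  apply: IH.
    by rewrite /= el ul.
    by rewrite /= ep al.
    move=> i; rewrite gE mulf_eq0 negb_or => /andP[ni /Hs].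
    rewrite !inE => /or3P[->//|/eqP h|->]; last by rewrite orbT.
    by rewrite h subrr eqxx in ni.
    have [h fE] := dvdpP _ _ Hd.
    rewrite /g; apply: dvdp_sub; last first.
      rewrite -mul_polyC; apply: dvdp_mull; apply: dvdp_trans Hd.
      by rewrite /= (exprS _ (size l).+1) dvdp_mulIr.
    apply: dvdp_mull; rewrite fE derivM deriv_exp /=.
    apply: dvdp_add; first by rewrite (exprS _ (size l).+1) mulrCA mulrA; apply: dvdp_mulIr.
    by rewrite -mulrnAl mulrA; apply: dvdp_mulIr.
rewrite gE => /eqP; rewrite mulf_eq0 => /orP[|/eqP//].
by rewrite (negPf (natr_inj_small ep cp nec)).
Qed.

(** Each exponent of [s] in turn plays the distinguished role in [lacunary_coef0]; the other
    exponents number at most M - 1, so order M at 1 suffices. *)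
Lemma lacunary_eq0 (s : seq nat) (f : {poly F}) (M : nat) :
  uniq s -> all (fun i => i < p)%N s -> (forall i, f`_i != 0 -> i \in s) ->
  (size s <= M)%N -> ('X - 1) ^+ M %| f -> f = 0.
Proof.
move=> us ap Hs sM Hd; apply/polyP => e; rewrite coef0.
apply/eqP; apply: contraT => fe; have es := Hs _ fe.
have pe : perm_eq s (e :: rem e s) by exact: perm_to_rem.
have s0 : (0 < size s)%N by case: (s) es.
suff h : f`_e = 0 by rewrite h eqxx in fe.
apply: (@lacunary_coef0 (rem e s)).
- by rewrite -(perm_uniq pe).
- by rewrite -(perm_all _ pe).
- by move=> i /Hs; rewrite (perm_mem pe).
- by rewrite size_rem// prednK//; apply: dvdp_trans Hd; apply: dvdp_exp2l.
Qed.

(* Unlike d/dX, the derivation X (X - 1) d/dX maps X^m (X - 1)^n to a polynomial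
   multiple of itself. *)
Definition xdd (f : {poly F}) := 'X * ('X - 1) * f^`().

(** Each application of [xdd] lowers the order at x by one and multiplies the leading value by x (x
    - 1) (D - k), which is nonzero as D < p. So [xdd] detects multiplicities up to p. *)
Lemma iter_xdd_mult (x : F) (g : {poly F}) (D k : nat) :
  (k <= D)%N -> (D < p)%N -> x != 0 -> x != 1 ->
  exists h : {poly F}, exists2 c : F, c != 0 &
    iter k xdd (g * ('X - x%:P) ^+ D) = h * ('X - x%:P) ^+ (D - k) /\
    h.[x] = c * g.[x].
Proof.
move=> kD Dp x0 x1; elim: k kD => [|k IH] kD.
  by exists g, 1; rewrite ?oner_neq0 // subn0 mul1r.
have [h [c c0 [hE hx]]] := IH (ltnW kD).
have [m mE] : exists m, (D - k)%N = m.+1 by exists (D - k.+1)%N; lia.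
exists ('X * ('X - 1) * (h^`() * ('X - x%:P) + h *+ m.+1)).
exists (c * (x * (x - 1) * m.+1%:R)).
  rewrite !mulf_neq0// ?subr_eq0// small_neq0//; lia.
split; last first.
  rewrite -polyC1 !(hornerM, hornerX, hornerXsubC, hornerD, hornerMn) hx subrr.
  by rewrite mulr0 add0r -mulr_natl; ring.
rewrite iterS hE mE; have -> : (D - k.+1 = m)%N by lia.
rewrite /xdd derivM deriv_exp derivXsubC mul1r /= exprS; ring.
Qed.

Lemma xdd_root_dvd (x : F) (f : {poly F}) (D : nat) :
  (D <= p)%N -> x != 0 -> x != 1 ->
  (forall k, (k < D)%N -> root (iter k xdd f) x) ->
  ('X - x%:P) ^+ D %| f.
Proof.
move=> Dp x0 x1; elim: D Dp => [|D IH] Dp Hr; first by rewrite expr0 dvd1p.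
have /dvdpP[g fE] : ('X - x%:P) ^+ D %| f.
  by apply: IH => [|k kD]; [exact: ltnW | apply: Hr; lia].
have [h [c c0 [hE hx]]] := iter_xdd_mult g (leqnn D) Dp x0 x1.
have := Hr D (ltnSn D); rewrite fE hE subnn expr0 mulr1 rootE hx mulf_eq0.
rewrite (negPf c0) /= -rootE -dvdp_XsubCl => /dvdpP[k ->].
by rewrite -mulrA -exprS dvdp_mulIr.
Qed.

Lemma sum_mult_lt_size (s : seq F) (f : {poly F}) (D : nat) :
  f != 0 -> uniq s -> (forall x, x \in s -> ('X - x%:P) ^+ D %| f) ->
  (size s * D < size f)%N.
Proof.
elim: s f => [|x s IH] f f0 /=; first by rewrite mul0n size_poly_gt0.
move=> /andP[xs us] Hd.
have /dvdpP[g fE] := Hd x (mem_head _ _).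
have g0 : g != 0 by apply: contraNneq f0; rewrite fE => ->; rewrite mul0r.
have : (size s * D < size g)%N.
  apply: IH => // y ys.
  have : ('X - y%:P) ^+ D %| f by apply: Hd; rewrite inE ys orbT.
  rewrite fE Gauss_dvdpl// coprimep_expl// coprimep_expr// coprimep_XsubC2//.
  by rewrite subr_eq0; apply: contraNneq xs => ->.
rewrite fE size_Mmonic ?monic_exp ?monicXsubC// size_exp_XsubC; lia.
Qed.

End Lacunary.

Lemma exists_lin_dep (F : fieldType) (I J : finType) (m : I -> J -> F) :
  (#|J| < #|I|)%N ->
  exists l : I -> F, (exists i, l i != 0) /\ forall j, \sum_i l i * m i j = 0.
Proof.
move=> JI.
pose M := \matrix_(i < #|I|, j < #|J|) m (enum_val i) (enum_val j).
have kM : kermx M != 0.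
  rewrite -mxrank_eq0 mxrank_ker subn_eq0 -ltnNge.
  by apply: leq_ltn_trans JI; exact: rank_leq_col.
have /rowV0Pn[v /sub_kermxP vM v0] := kM.
exists (fun i => v 0 (enum_rank i)); split.
  have /rV0Pn[i vi] := v0.
  by exists (enum_val i); rewrite enum_valK.
move=> j; have /matrixP/(_ 0 (enum_rank j)) := vM; rewrite !mxE => h.
rewrite -[RHS]h (reindex (@enum_rank I)) /=; last first.
  by exists enum_val => i _; rewrite ?enum_rankK ?enum_valK.
by apply: eq_bigr => i _; rewrite !mxE !enum_rankK.
Qed.

(** * Iterates of the derivation on X^m (X - 1)^n *)

Section XddMonomials.
Variable F : fieldType.

(** The cofactor of X^m (X - 1)^n after k applications of [xdd], by the product rule. Its degree is
    at most k whatever m and n are, which keeps the number of linear conditions in [stepanov]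
    small. *)
Fixpoint xdd_fac (m n k : nat) : {poly F} :=
  if k is k'.+1 then
    'X * ('X - 1) * (xdd_fac m n k')^`() +
    (m%:R *: ('X - 1) + n%:R *: 'X) * xdd_fac m n k'
  else 1.

Lemma iter_xdd_mono m n k :
  iter k (@xdd F) ('X^m * ('X - 1) ^+ n) =
  xdd_fac m n k * ('X^m * ('X - 1) ^+ n).
Proof.
elim: k => [|k IH] /=; first by rewrite mul1r.
rewrite IH; set q := xdd_fac m n k.
rewrite /xdd !derivM derivXn deriv_exp derivB derivX -polyC1 derivC subr0 mul1r polyC1.
rewrite -!mul_polyC !polyC_natr.
case: m {IH q} (q) => [|m] q; case: n => [|n]; rewrite /= ?exprS; ring.
Qed.

Lemma size_xdd_fac m n k : (size (xdd_fac m n k) <= k.+1)%N.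
Proof.
elim: k => [|k IH] /=; first by rewrite size_poly1.
have s2 : (size (m%:R *: ('X - 1) + n%:R *: 'X : {poly F})%R <= 2)%N.
  rewrite (leq_trans (size_polyD _ _))// geq_max.
  rewrite !(leq_trans (size_scale_leq _ _))// ?size_polyX//.
  by rewrite -polyC1 size_XsubC.
rewrite (leq_trans (size_polyD _ _))// geq_max; apply/andP; split.
  have [->|d0] := eqVneq (xdd_fac m n k)^`() 0; first by rewrite mulr0 size_poly0.
  have q0 : xdd_fac m n k != 0.
    by apply: contraNneq d0 => ->; rewrite linear0.
  have sd : (size (xdd_fac m n k)^`() <= k)%N.
    by rewrite -ltnS; apply: leq_trans (lt_size_deriv q0) IH.
  have h3 : (size ('X * ('X - 1) : {poly F})%R <= 3)%N.
    by have := size_polyMleq ('X : {poly F}) ('X - 1%:P); rewrite size_polyX size_XsubC.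
  apply: leq_trans (size_polyMleq _ _) _.
  by have := leq_add h3 sd; case: (_ + _)%N.
apply: leq_trans (size_polyMleq _ _) _.
by have := leq_add s2 IH; case: (_ + _)%N.
Qed.

Lemma iter_xdd_sum (I : finType) (l : I -> F) (f : I -> {poly F}) k :
  iter k (@xdd F) (\sum_i l i *: f i) = \sum_i l i *: iter k (@xdd F) (f i).
Proof.
elim: k => [//|k IH]; rewrite !iterS IH /xdd raddf_sum /= mulr_sumr.
by apply: eq_bigr => i _; rewrite derivZ scalerAr.
Qed.

End XddMonomials.

(** * The auxiliary polynomial *)

Section Stepanov.
Variables (F : finFieldType) (p t A B : nat).
Hypothesis small_neq0 : forall k, (0 < k < p)%N -> k%:R != 0 :> F.
Hypotheses (A_gt0 : (0 < A)%N) (B_gt0 : (0 < B)%N).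
Hypotheses (AB : (A * B <= t)%N) (AtB : (A + t * B <= p)%N).

Local Notation idx := ('I_A * 'I_B * 'I_B)%type.

(** At a point x of class (u, v) this takes the value x^a u^b v^c, a polynomial in x of degree below
    A once the class is fixed. *)
Definition mono (i : idx) : {poly F} :=
  'X^(i.1.1 + t * i.1.2)%N * ('X - 1) ^+ (t * i.2)%N.

Lemma mono_exp_inj (a a' : 'I_A) (b b' : 'I_B) :
  (a + t * b = a' + t * b')%N -> a = a' /\ b = b'.
Proof.
move=> h; have At : (A <= t)%N by apply: leq_trans AB; apply: leq_pmulr.
have t0 : (0 < t)%N by apply: leq_trans At.
have [at_ at'] : (a < t /\ a' < t)%N.
  by split; [have := ltn_ord a | have := ltn_ord a']; lia.
have hb : (b = b' :> nat) by nia.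
split; apply: val_inj => //=; rewrite hb in h; lia.
Qed.

(** The coefficient of (X - 1)^(tc) in a combination of the [mono]: a lacunary polynomial with at
    most AB <= t terms, of exponents below p. *)
Definition layer (l : idx -> F) (c : 'I_B) : {poly F} :=
  \sum_(i : 'I_A * 'I_B) l (i, c) *: 'X^(i.1 + t * i.2)%N.

Lemma sum_layers (l : idx -> F) :
  \sum_i l i *: mono i = \sum_c layer l c * ('X - 1) ^+ (t * c)%N.
Proof.
under [RHS]eq_bigr do rewrite mulr_suml.
rewrite exchange_big pair_bigA /=.
by apply: eq_bigr => -[[a b] c] _; rewrite /mono /= scalerAl.
Qed.

Lemma coef_layer l c (a : 'I_A) (b : 'I_B) : (layer l c)`_(a + t * b)%N = l (a, b, c).
Proof.
rewrite coef_sum (bigD1 (a, b)) //= coefZ coefXn eqxx mulr1 big1 ?addr0//.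
move=> -[a' b'] /= ne; rewrite coefZ coefXn; case: eqP => [/mono_exp_inj[aa bb]|_].
  by rewrite aa bb eqxx in ne.
by rewrite mulr0.
Qed.

Lemma layer_eq0 l c : ('X - 1) ^+ t %| layer l c -> layer l c = 0.
Proof.
pose s := [seq (i.1 + t * i.2)%N | i : ('I_A * 'I_B)%type].
apply: (@lacunary_eq0 F p small_neq0 s).
- rewrite map_inj_uniq ?enum_uniq// => -[a b] [a' b'] /= /mono_exp_inj[-> ->] //.
- apply/allP => e /mapP[[a b] _ ->] /=.
  have := ltn_ord a; have := ltn_ord b; nia.
- move=> e; rewrite coef_sum => h.
  apply: contraNT h => es; apply/eqP; apply: big1 => -[a b] _ /=.
  rewrite coefZ coefXn; case: eqP => [ee|_]; last by rewrite mulr0.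
  by case/negP: es; rewrite ee; apply/mapP; exists (a, b); rewrite ?mem_enum.
- by rewrite size_map -cardE card_prod !card_ord.
Qed.

(** If the layers before c vanish, those after c carry a factor (X - 1)^(t(c+1)), so (X - 1)^t
    divides layer c. This exceeds what its number of terms allows, and layer c vanishes too. *)
Lemma mono_free (l : idx -> F) : \sum_i l i *: mono i = 0 -> forall i, l i = 0.
Proof.
rewrite sum_layers => h.
have L0 (n : nat) : forall c : 'I_B, (c < n)%N -> layer l c = 0.
  elim: n => [//|n IH] c; rewrite ltnS leq_eqVlt => /orP[/eqP cn|]; last exact: IH.
  apply: layer_eq0; have X0 : ('X - 1 : {poly F}) != 0 by rewrite -polyC1 polyXsubC_eq0.
  rewrite -(@dvdp_mul2r _ (('X - 1) ^+ (t * c)%N)) ?expf_neq0//.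
  move: h; rewrite (bigD1 c) //= => /eqP; rewrite addr_eq0 => /eqP ->.
  rewrite -exprD dvdpNr; apply: (big_ind (fun q => _ %| q)); rewrite ?dvdp0//.
    exact: dvdp_add.
  move=> c' ne; case: (ltnP c' n) => [/IH ->|nc']; first by rewrite mul0r dvdp0.
  apply: dvdp_mull; apply: dvdp_exp2l; rewrite -{1}(muln1 t) -mulnDr leq_mul2l.
  apply/orP; right; rewrite add1n ltn_neqAle cn nc' andbT -cn.
  by rewrite eq_sym (inj_eq val_inj).
by move=> [[a b] c]; rewrite -coef_layer (L0 B c) ?coef0.
Qed.

Lemma size_mono i : (size (mono i) <= A + 2 * t * B)%N.
Proof.
rewrite /mono size_Mmonic ?monic_exp -?polyC1 ?monicXsubC ?monic_neq0 ?monicXn//.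
rewrite size_polyXn size_exp_XsubC.
case: i => [[a b] c] /=; have := ltn_ord a; have := ltn_ord b; have := ltn_ord c.
nia.
Qed.

(** There are A B^2 free coefficients. Vanishing of the first A iterates of [xdd] on all points with
    class in T costs 2A conditions per class and iterate, hence 2 A^2 |T| in all. A nonzero solution
    has a root of order A at every such point, and its degree bounds their number. *)
Theorem stepanov (T : {set F * F}) :
  (2 * #|T| * A < B ^ 2)%N ->
  (A * #|[set x : F | [&& x != 0, x != 1 & (x ^+ t, (x - 1) ^+ t) \in T]]%R|
     <= A + 2 * t * B)%N.
Proof.
move=> hT.
pose J : finType := ('I_#|T| * 'I_A * 'I_(2 * A))%type.
pose m (i : idx) (j : J) : F :=
  let uv := enum_val j.1.1 in
  uv.1 ^+ i.1.2 * uv.2 ^+ i.2 *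
  (xdd_fac F (i.1.1 + t * i.1.2) (t * i.2) j.1.2 * 'X^(i.1.1))`_j.2.
have cJ : (#|J| < #|(idx : finType)|)%N.
  rewrite !card_prod !card_ord; nia.
have [l [[i0 li0] lm]] := exists_lin_dep m cJ.
pose Psi := \sum_i l i *: mono i.
have Psi0 : Psi != 0.
  by apply/eqP => /mono_free/(_ i0) h; rewrite h eqxx in li0.
have sPsi : (size Psi <= A + 2 * t * B)%N.
  apply: leq_trans (size_sum _ _ _) _; apply/bigmax_leqP => i _.
  exact: leq_trans (size_scale_leq _ _) (size_mono i).
set X := [set x | _].
have := @sum_mult_lt_size F (enum X) Psi A Psi0 (enum_uniq _).
rewrite -cardE mulnC => H; apply: ltnW; apply: leq_trans sPsi; apply: H => x.
rewrite mem_enum inE => /and3P[x0 x1 xT].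
apply: (xdd_root_dvd small_neq0) => //; first by apply: leq_trans AtB; apply: leq_addr.
move=> k kA; rewrite iter_xdd_sum rootE horner_sum.
pose a := enum_rank_in xT (x ^+ t, (x - 1) ^+ t).
(* Q is the k-th iterate with X^t and (X - 1)^t replaced by their values at x. Its degree is at most
   k + A - 1 < 2A, and its coefficients are the linear forms that [l] annihilates. *)
pose Q := \sum_(i : idx) (l i * (x ^+ t) ^+ i.1.2 * ((x - 1) ^+ t) ^+ i.2) *:
   (xdd_fac F (i.1.1 + t * i.1.2) (t * i.2) k * 'X^(i.1.1)).
have -> : \sum_(i : idx) (l i *: iter k (@xdd F) (mono i)).[x] = Q.[x].
  rewrite /Q horner_sum; apply: eq_bigr => i _.
  rewrite iter_xdd_mono -polyC1 !(hornerZ, hornerM, hornerXn, horner_exp, hornerXsubC).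
  rewrite exprD !exprM; ring.
suff -> : Q = 0 by rewrite horner0.
apply/polyP => e; rewrite coef0 coef_sum.
have [e2|e2] := ltnP e (2 * A); last first.
  apply: big1 => i _; rewrite coefZ nth_default ?mulr0//; apply: leq_trans e2.
  apply: leq_trans (size_polyMleq _ _) _; rewrite size_polyXn addnS /=.
  apply: leq_trans (leq_add (size_xdd_fac _ _ _ _) (leqnn _)) _.
  by case: (i.1.1) => n /= nA; rewrite mul2n -addnn leq_add// ltnW.
rewrite -[RHS](lm (a, Ordinal kA, Ordinal e2)); apply: eq_bigr => i _.
by rewrite /m /= /a enum_rankK_in // coefZ !mulrA.
Qed.

End Stepanov.

(** * Level sets of N *)

Section LevelSets.
Variables (F : finFieldType) (p t : nat).
Hypothesis small_neq0 : forall k, (0 < k < p)%N -> k%:R != 0 :> F.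
Hypothesis tp : (t <= p)%N.

Definition cls (x : F) : F * F := (x ^+ t, (x - 1) ^+ t).

Definition clsN (c : F * F) : nat :=
  #|[set x : F | [&& x != 0, x != 1 & cls x == c]]|.

Lemma card_cls_preim (T : {set F * F}) :
  #|[set x : F | [&& x != 0, x != 1 & cls x \in T]]| = (\sum_(c in T) clsN c)%N.
Proof.
rewrite -sum1_card (partition_big cls (mem T)) /=; last first.
  by move=> x; rewrite inE => /and3P[].
apply: eq_bigr => c cT; rewrite /clsN -sum1_card; apply: eq_bigl => x.
rewrite !inE -!andbA; by case: (cls x =P c) => [->|_]; rewrite ?cT ?andbF ?andbT.
Qed.

Lemma exists_subset_card (T : finType) (X : {set T}) n :
  (n <= #|X|)%N -> exists2 Y : {set T}, Y \subset X & #|Y| = n.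
Proof.
move=> nX; exists [set x in take n (enum X)].
  by apply/subsetP => x; rewrite inE => /mem_take; rewrite mem_enum.
rewrite cardsE (card_uniqP _) ?take_uniq ?enum_uniq// size_take -cardE.
by case: ltnP => // h; apply/eqP; rewrite eqn_leq h nX.
Qed.

(** Stepanov's bound with B = floor(t / A). As 8A <= t, rounding costs little: 7t < 8AB, hence t^2 <
    2 (AB)^2. The condition A + tB <= p holds since both terms are at most p / 2. *)
Lemma stepanov_cls (A : nat) (T : {set F * F}) :
  (0 < A)%N -> (2 * t ^ 2 <= p * A)%N -> (64 * A ^ 3 <= t ^ 2)%N ->
  (8 * #|T| * A ^ 3 <= t ^ 2)%N ->
  (A ^ 2 * \sum_(c in T) clsN c <= A ^ 2 + 2 * t ^ 2)%N.
Proof.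
move=> A0 pA At hT; pose B := (t %/ A)%N.
have A8 : (8 * A <= t)%N by nia.
have BAt : (A * B <= t)%N by rewrite mulnC leq_trunc_div.
have tB : (t < A * B.+1)%N by rewrite mulnC ltn_ceil.
have B7 : (7 <= B)%N by nia.
have AtB : (A + t * B <= p)%N.
  have : (2 * (A * (t * B)) <= A * p)%N by nia.
  have : (2 * A <= p)%N by lia.
  nia.
have h49 : (t ^ 2 < 2 * (A * B) ^ 2)%N.
  have : (7 * t < 8 * (A * B))%N by nia.
  nia.
have h : (2 * #|T| * A < B ^ 2)%N.
  have A2 : (0 < A ^ 2)%N by rewrite expn_gt0 A0.
  rewrite -(ltn_pmul2r A2); move: h49 hT; rewrite expnMn !expnS expn0; lia.
have := @stepanov F p t A B small_neq0 A0 (leq_trans (isT : 0 < 7)%N B7) BAt AtB T h.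
rewrite card_cls_preim => {}h.
have : (A * (A * (\sum_(c in T) clsN c)) <= A * (A + 2 * t * B))%N by rewrite leq_mul2l h orbT.
move: BAt; rewrite !expnS expn0; nia.
Qed.

(** Otherwise n = floor(t^2 / (16 A^3)) >= 4 of these classes can be chosen. They contribute at
    least 64 n A^3 to the left side of [stepanov_cls], while its right side A^2 + 2 t^2 is below 41
    n A^3. *)
Lemma level_set_small (A : nat) :
  (0 < A)%N -> (2 * t ^ 2 <= p * A)%N -> (64 * A ^ 3 <= t ^ 2)%N ->
  (16 * A ^ 3 * #|[set c | 64 * A <= clsN c]| <= t ^ 2)%N.
Proof.
move=> A0 pA At; rewrite leqNgt; apply/negP => big.
pose n := (t ^ 2 %/ (16 * A ^ 3))%N.
have A3 : (0 < A ^ 3)%N by rewrite expn_gt0 A0.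
have n1 : (n * (16 * A ^ 3) <= t ^ 2)%N by rewrite leq_trunc_div.
have n2 : (t ^ 2 < n.+1 * (16 * A ^ 3))%N by rewrite ltn_ceil// muln_gt0.
have n4 : (4 <= n)%N by nia.
have [|Y /subsetP YX Yn] := @exists_subset_card _ [set c | 64 * A <= clsN c]%N n.
  by nia.
have := @stepanov_cls A Y A0 pA At; rewrite Yn => /(_ ltac:(nia)).
have : (n * (64 * A) <= \sum_(c in Y) clsN c)%N.
  rewrite -Yn -sum_nat_const; apply: leq_sum => c /YX; by rewrite inE.
set s := (\sum_(c in Y) _)%N => h1 h2.
have : (n * (64 * A ^ 3) <= A ^ 2 * s)%N.
  have -> : (n * (64 * A ^ 3) = A ^ 2 * (n * (64 * A)))%N by ring.
  by rewrite leq_mul2l h1 orbT.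
have : (A ^ 2 <= A ^ 3)%N by rewrite leq_pexp2l.
nia.
Qed.

Lemma clsN_le (A : nat) c :
  (0 < A)%N -> (2 * t ^ 2 <= p * A)%N -> (64 * A ^ 3 <= t ^ 2)%N ->
  (A ^ 2 * clsN c <= A ^ 2 + 2 * t ^ 2)%N.
Proof.
move=> A0 pA At; have := @stepanov_cls A [set c] A0 pA At.
rewrite cards1 big_set1; apply; lia.
Qed.

(* Above the largest admissible A, [clsN_le] bounds every clsN by
   1 + 1024 A; any constant exceeding 1025 would do. *)
Definition lev : nat := 35 * 32.

(** Removes the restriction 64 A^3 <= t^2: beyond the largest admissible value A1, the pointwise
    bound N <= 1 + 1024 A1 leaves the level set empty. *)
Lemma level_set_card (A0 A : nat) :
  (0 < A0)%N -> (2 * t ^ 2 <= p * A0)%N -> (64 * A0 ^ 3 <= t ^ 2)%N ->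
  (A0 <= A)%N ->
  (16 * A ^ 3 * #|[set c | lev * A <= clsN c]| <= t ^ 2)%N.
Proof.
move=> A00 pA At AA.
have [At'|At'] := leqP (64 * A ^ 3) (t ^ 2).
  apply: leq_trans (level_set_small _ _ At'); [|lia|nia].
  rewrite leq_mul2l; apply/orP; right; apply: subset_leq_card.
  by apply/subsetP => c; rewrite !inE /lev; lia.
have ex1 : exists a, (64 * a ^ 3 <= t ^ 2)%N by exists A0.
have ub1 a : (64 * a ^ 3 <= t ^ 2)%N -> (a <= A)%N.
  move=> ha; rewrite leqNgt; apply/negP => Aa.
  have : (A ^ 3 <= a ^ 3)%N by rewrite leq_exp2r// ltnW.
  lia.
have [A1 A1t A1max] := ex_maxnP ex1 ub1.
have A01 : (A0 <= A1)%N by apply: A1max.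
have A1A : (A1 < A)%N.
  rewrite ltnNge; apply/negP => Aa.
  have : (A ^ 3 <= A1 ^ 3)%N by rewrite leq_exp2r.
  lia.
have t1 : (t ^ 2 < 64 * A1.+1 ^ 3)%N.
  by rewrite ltnNge; apply/negP => /A1max; rewrite ltnn.
have t2 : (A1.+1 ^ 3 <= (2 * A1) ^ 3)%N by rewrite leq_exp2r//; lia.
rewrite (_ : [set c | _] = set0) ?cards0 ?muln0//.
apply/setP => c; rewrite !inE; apply/negbTE; rewrite -ltnNge.
have := @clsN_le A1 c ltac:(lia) ltac:(nia) A1t.
have A12 : (0 < A1 ^ 2)%N by rewrite expn_gt0; apply/orP; left; lia.
move=> h; have : (A1 ^ 2 * clsN c <= A1 ^ 2 * (1 + 1024 * A1))%N.
  apply: leq_trans h _; move: t1 t2; rewrite expnMn !expnS expn0; lia.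
rewrite leq_pmul2l// => h'.
rewrite /lev; lia.
Qed.

(** Dyadic decomposition of the values of N. The level b = 2^i A0 has at most t^2 / (16 b^3)
    classes, each charged (2 lev b)^3, so it contributes at most lev^3 t^2; since N <= |F| < 2^L, L
    levels suffice. *)
Lemma sum_cube_clsN (A0 L : nat) :
  (0 < A0)%N -> (2 * t ^ 2 <= p * A0)%N -> (64 * A0 ^ 3 <= t ^ 2)%N ->
  (#|F| < 2 ^ L)%N ->
  (\sum_(c | lev * A0 <= clsN c) clsN c ^ 3 <= L * (lev ^ 3 * t ^ 2))%N.
Proof.
move=> A00 pA At FL; pose a i := (lev * (A0 * 2 ^ i))%N.
have l0 : (0 < lev * A0)%N by rewrite muln_gt0.
have dy c : (lev * A0 <= clsN c)%N ->
  (clsN c ^ 3 <= \sum_(i < L) (a i <= clsN c) * (2 * a i) ^ 3)%N.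
  move=> h; pose q := (clsN c %/ (lev * A0))%N.
  have q0 : (0 < q)%N by rewrite divn_gt0.
  have /andP[k1 k2] := trunc_log_bounds (isT : 1 < 2)%N q0.
  have qc : (q * (lev * A0) <= clsN c)%N by rewrite leq_trunc_div.
  have cq : (clsN c < q.+1 * (lev * A0))%N by rewrite ltn_ceil.
  set k := trunc_log 2 q in k1 k2.
  have kL : (k < L)%N.
    rewrite -(ltn_exp2l _ _ (isT : 1 < 2)%N); apply: leq_ltn_trans FL.
    apply: leq_trans k1 _; apply: leq_trans (leq_div _ _) _.
    exact: max_card.
  rewrite (bigD1 (Ordinal kL)) //=; apply: leq_trans (leq_addr _ _).
  have -> : (a k <= clsN c)%N by rewrite /a; nia.
  by rewrite mul1n leq_exp2r// /a; move: k2; rewrite expnS; nia.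
apply: (@leq_trans (\sum_(c | lev * A0 <= clsN c)
   \sum_(i < L) (a i <= clsN c) * (2 * a i) ^ 3)%N).
  by apply: leq_sum => c; exact: dy.
rewrite exchange_big /= -[X in (_ <= X * _)%N](card_ord L) -sum_nat_const.
apply: leq_sum => i _; rewrite -big_distrl /= -/(a i).
apply: (@leq_trans (#|[set c | lev * (A0 * 2 ^ i) <= clsN c]%N| * (2 * a i) ^ 3)).
  rewrite leq_mul2r; apply/orP; right; rewrite -sum1_card big_mkcond [leqRHS]big_mkcond.
  by apply: leq_sum => c _; rewrite inE /a; case: ifP; case: ifP.
have := @level_set_card A0 (A0 * 2 ^ i) A00 pA At.
rewrite leq_pmulr ?expn_gt0// => /(_ isT).
rewrite /a; set n := #|_|; set b := (A0 * 2 ^ i)%N => h; rewrite !(expnMn _ _ 3).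
have : (16 * b ^ 3 * n * lev ^ 3 <= t ^ 2 * lev ^ 3)%N by rewrite leq_mul2r h orbT.
nia.
Qed.
End LevelSets.

(** * Energy and sumset *)

(* Tangent line trick: [q^3 >= 3 a^2 q - 2 a^3] for [q = r / m], with [a] the
   ratio of the two sums. *)
Lemma holder_cube (K : realFieldType) (I : finType) (P : pred I) (r m : I -> K) :
  (forall i, P i -> 0 <= r i) -> (forall i, P i -> 0 < m i) ->
  (\sum_(i | P i) r i) ^+ 3 <=
  (\sum_(i | P i) m i) ^+ 2 * \sum_(i | P i) r i ^+ 3 / m i ^+ 2.
Proof.
move=> r0 m0; set Z := \sum_(i | P i) r i; set M := \sum_(i | P i) m i.
have Z0 : 0 <= Z by apply: sumr_ge0.
have [M0|M0] := eqVneq M 0.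
  rewrite M0 expr0n mul0r; suff -> : Z = 0 by rewrite expr0n.
  apply: big1 => i Pi; have := m0 i Pi.
  by rewrite (psumr_eq0P _ M0) ?ltxx// => j /m0/ltW.
have Mp : 0 < M by rewrite lt_def M0 sumr_ge0// => i /m0/ltW.
pose a := Z / M; have a0 : 0 <= a by rewrite divr_ge0// ltW.
have ZE : Z = a * M by rewrite divfK.
suff : 3 * a ^+ 2 * Z - 2 * a ^+ 3 * M <= \sum_(i | P i) r i ^+ 3 / m i ^+ 2.
  move=> h; apply: le_trans (ler_wpM2l (sqr_ge0 M) h).
  by rewrite ZE le_eqVlt; apply/orP; left; apply/eqP; ring.
rewrite !mulr_sumr -sumrB; apply: ler_sum => i Pi.
have mi := m0 i Pi; pose q := r i / m i.
have q0 : 0 <= q by rewrite divr_ge0 ?r0// ltW.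
have rE : r i = q * m i by rewrite divfK// gt_eqF.
have -> : r i ^+ 3 / m i ^+ 2 = q ^+ 3 * m i.
  by rewrite rE; field; rewrite gt_eqF.
rewrite rE -subr_ge0.
have -> : q ^+ 3 * m i - (3 * a ^+ 2 * (q * m i) - 2 * a ^+ 3 * m i) =
   (q - a) ^+ 2 * (q + 2 * a) * m i by ring.
apply: mulr_ge0 (ltW mi); apply: mulr_ge0; first exact: sqr_ge0.
by apply: addr_ge0 => //; apply: mulr_ge0.
Qed.

Lemma expn3_add_le x y : ((x + y) ^ 3 <= 4 * (x ^ 3 + y ^ 3))%N.
Proof.
wlog xy : x y / (x <= y)%N.
  move=> h; case/orP: (leq_total x y) => [|/h]; first exact: h.
  by rewrite addnC [(y ^ 3 + _)%N]addnC.
rewrite -(subnKC xy); set d := (y - x)%N.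
suff -> : (4 * (x ^ 3 + (x + d) ^ 3) = (x + (x + d)) ^ 3 + 3 * (x + x + d) * d ^ 2)%N.
  exact: leq_addr.
ring.
Qed.

Section EnergySumset.
Variables (F : finFieldType) (t : nat).

(** R is represented as the set of t-th roots of unity, so that membership is an equation. The
    hypothesis [card_mroots] says that F contains t of them, i.e. that t divides |F| - 1. *)
Definition mroots : {set F} := [set x | x ^+ t == 1].
Definition msum : {set F} := [set x + y | x in mroots, y in mroots].
Definition rep (d : F) : nat := #|[set y in mroots | y - d \in mroots]|.
Definition energy : nat := \sum_d rep d ^ 2.

Hypotheses (t_gt0 : (0 < t)%N) (card_mroots : #|mroots| = t).

Lemma mroots_neq0 x : x \in mroots -> x != 0.
Proof.
rewrite inE; apply: contraTneq => ->.
by rewrite expr0n (gtn_eqF t_gt0) /= eq_sym oner_eq0.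
Qed.

(** Put x = y / d: then x - 1 = (y - d) / d, and y, y - d both lie in R exactly when x and x - 1
    have t-th power d^-t. *)
Lemma rep_clsN d : d != 0 -> rep d = clsN t ((d ^+ t)^-1, (d ^+ t)^-1).
Proof.
move=> d0; have dt0 : d ^+ t != 0 by rewrite expf_neq0.
rewrite /rep -(card_imset _ (mulIf (invr_neq0 d0))); congr #|pred_of_set _|.
apply/setP => x; rewrite !inE; apply/imsetP/idP.
  move=> [y]; rewrite inE => /andP[yR ydR] ->.
  rewrite mulf_neq0 ?invr_neq0 // ?mroots_neq0//=.
  apply/andP; split.
    rewrite -subr_eq0; have -> : y / d - 1 = (y - d) / d by rewrite mulrBl divff.
    by rewrite mulf_neq0 ?invr_neq0 // ?mroots_neq0.
  move: yR ydR; rewrite !inE /cls => /eqP y1 /eqP y2.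
  have -> : y / d - 1 = (y - d) / d by rewrite mulrBl divff.
  by rewrite !exprMn y1 y2 !mul1r !exprVn.
move=> /and3P[x0 x1 /eqP[h1 h2]]; exists (x * d); last by rewrite mulfK.
rewrite inE !inE exprMn h1 mulVf// eqxx /=.
have -> : x * d - d = (x - 1) * d by ring.
by rewrite exprMn h2 mulVf.
Qed.

Lemma rep_le d : (rep d <= t)%N.
Proof.
rewrite -card_mroots; apply: subset_leq_card.
by apply/subsetP => y; rewrite !inE => /andP[].
Qed.

Lemma energy_pairs :
  energy = (\sum_(y in mroots) \sum_(z in mroots) rep (y - z)%R)%N.
Proof.
rewrite /energy exchange_big /=.
have -> : (\sum_(z in mroots) \sum_(y in mroots) rep (y - z)%R =
  \sum_(z in mroots) \sum_(d | (d + z)%R \in mroots) rep d)%N.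
  apply: eq_bigr => z _; rewrite (reindex_inj (addIr z)) /=.
  by apply: eq_bigr => d _; rewrite addrK.
rewrite (exchange_big_dep predT) //=; apply: eq_bigr => d _.
rewrite sum_nat_const -mulnn; congr (_ * _)%N.
rewrite /rep -(card_imset _ (addIr (- d))).
apply: eq_card => z; rewrite -topredE /=; apply/imsetP/andP.
  by move=> [y]; rewrite inE => /andP[yR yd] ->; rewrite subrKC.
move=> [zR zd]; have e : d + z - d = z by rewrite addrC addKr.
by exists (d + z); rewrite ?e // in_set zd e.
Qed.

(** * Sorting pairs of roots of unity by the ratio (1 + y) / (1 + z) *)

Definition ratio (w : F * F) : F := (1 + w.1) / (1 + w.2).
Definition good_pairs : {set F * F} :=
  [set w | [&& w.1 \in mroots, w.2 \in mroots, 1 + w.1 != 0, 1 + w.2 != 0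
             & w.1 != w.2]].
(* If x has class c, the pairs (y, z) of roots of unity with ratio x correspond to
   the elements of class [cls_swap c] through (y, z) |-> y / (x - 1). *)
Definition cls_swap (c : F * F) : F * F := (c.2^-1, c.1 / c.2).

Lemma good_pairsP w : w \in good_pairs ->
  [/\ w.1 \in mroots, w.2 \in mroots, 1 + w.1 != 0, 1 + w.2 != 0 & w.1 != w.2].
Proof. by rewrite inE => /and5P[]. Qed.

Lemma ratio_sub1 w : w \in good_pairs -> ratio w - 1 = (w.1 - w.2) / (1 + w.2).
Proof. by move=> /good_pairsP[_ _ _ h _]; rewrite /ratio; field. Qed.

Lemma ratio_neq w : w \in good_pairs -> ratio w != 0 /\ ratio w != 1.
Proof.
move=> wg; have [_ _ h1 h2 ne] := good_pairsP wg.
split; first by rewrite mulf_neq0 ?invr_neq0.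
by rewrite -subr_eq0 ratio_sub1// mulf_neq0 ?invr_neq0// subr_eq0.
Qed.

Lemma cls_ratio w : w \in good_pairs -> cls t (ratio w) =
  ((1 + w.1) ^+ t / (1 + w.2) ^+ t, (w.1 - w.2) ^+ t / (1 + w.2) ^+ t).
Proof. by move=> wg; rewrite /cls ratio_sub1// /ratio !exprMn !exprVn. Qed.

(** From y = x (1 + z) - 1 one gets y / (x - 1) - 1 = x z / (x - 1), which determines the class of y
    / (x - 1). *)
Lemma ratio_fiber x : x != 0 -> x != 1 ->
  (#|[set w in good_pairs | ratio w == x]| <= clsN t (cls_swap (cls t x)))%N.
Proof.
move=> x0 x1; have x10 : x - 1 != 0 by rewrite subr_eq0.
have yE w : w \in [set w in good_pairs | ratio w == x] ->
    w.1 = x * (1 + w.2) - 1.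
  rewrite inE => /andP[/good_pairsP[_ _ _ h _] /eqP <-].
  by rewrite /ratio divfK// addrC addKr.
rewrite -(@card_in_imset _ _ (fun w => w.1 / (x - 1))); last first.
  move=> w w' /yE h /yE h' /(mulIf (invr_neq0 x10)) e.
  have e2 : w.2 = w'.2.
    by move: e; rewrite h h' => /addIr /(mulfI x0) /addrI.
  by case: w w' e e2 {h h'} => [a b] [a' b'] /= -> ->.
apply: subset_leq_card; apply/subsetP => v /imsetP[w wx ->].
have wE := yE _ wx.
move: wx; rewrite inE => /andP[/good_pairsP[y1 y2 _ _ _] _].
have e : w.1 / (x - 1) - 1 = x * w.2 / (x - 1) by rewrite wE; field.
rewrite inE mulf_neq0 ?invr_neq0 // ?mroots_neq0//= -subr_eq0 e.
rewrite !mulf_neq0 ?invr_neq0 // ?mroots_neq0//= /cls e /cls_swap /=.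
move: y1 y2; rewrite !inE => /eqP y1 /eqP y2.
by rewrite !exprMn y1 y2 mul1r mulr1 !exprVn.
Qed.

Lemma cls_fiber c :
  (#|[set w in good_pairs | cls t (ratio w) == c]|
     <= clsN t c * clsN t (cls_swap c))%N.
Proof.
rewrite -sum1_card (partition_big ratio
   (fun x => x \in [set x : F | [&& x != 0, x != 1 & cls t x == c]])) /=; last first.
  move=> w; rewrite in_set => /andP[/ratio_neq[h0 h1] h2].
  by rewrite in_set h0 h1 h2.
rewrite -sum_nat_const; apply: leq_sum => x; rewrite inE => /and3P[x0 x1 /eqP <-].
apply: leq_trans (ratio_fiber x0 x1); rewrite -[leqRHS]sum1_card.
rewrite big_mkcond [leqRHS]big_mkcond; apply: leq_sum => w _.
rewrite 2!in_set; case: (w \in good_pairs) => //=.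
by case: (ratio w == x); rewrite ?andbF ?andbT//; case: ifP.
Qed.

Lemma cls_swap_inj :
  {in [pred c | (c.1 != 0) && (c.2 != 0)] &, injective cls_swap}.
Proof.
move=> [a b] [a' b'] /andP[/= a0 b0] /andP[/= a0' b0'] [] /invr_inj -> h.
by congr pair; apply: mulIf h; rewrite invr_neq0.
Qed.

(** The weight for Hoelder's inequality. With c the class of the ratio, at most N(c) N([cls_swap] c)
    <= [mult]^2 good pairs share c, so dividing by [mult]^2 cancels the fibre size, while the sum of
    [mult] is controlled by sums of N^3. *)
Definition mult (w : F * F) : nat :=
  maxn (clsN t (cls t (ratio w))) (clsN t (cls_swap (cls t (ratio w)))).

Lemma mult_gt0 w : w \in good_pairs -> (0 < mult w)%N.
Proof.
move=> /ratio_neq[r0 r1]; apply: leq_trans (leq_maxl _ _).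
by apply/card_gt0P; exists (ratio w); rewrite inE r0 r1 eqxx.
Qed.

Lemma card_good_pairs : (#|good_pairs| <= t ^ 2)%N.
Proof.
apply: leq_trans (_ : #|setX mroots mroots| <= _)%N.
  by apply: subset_leq_card; apply/subsetP => -[a b] /good_pairsP[h1 h2 _ _ _]; rewrite inE h1.
by rewrite cardsX card_mroots mulnn.
Qed.

Definition cube_above (H : nat) : nat :=
  \sum_(c : F * F | (H <= clsN t c)%N) clsN t c ^ 3.

(** Pairs of weight below H give at most H t^2. The others, grouped by class c, give at most M N(c)
    N([cls_swap] c) <= M^3, where M >= H is the larger of the two values; injectivity of [cls_swap]
    then yields the factor 2. *)
Lemma sum_mult H : (\sum_(w in good_pairs) mult w <= H * t ^ 2 + 2 * cube_above H)%N.
Proof.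
pose N := clsN (F := F) t; pose M c := maxn (N c) (N (cls_swap c)).
pose g c := (if H <= N c then N c ^ 3 else 0)%N.
pose D := [pred c : F * F | (c.1 != 0) && (c.2 != 0)].
have KE : cube_above H = (\sum_c g c)%N by rewrite /cube_above big_mkcond.
apply: (@leq_trans (\sum_(w in good_pairs)
   (H + (if H <= mult w then mult w else 0)))%N).
  apply: leq_sum => w _; case: (leqP H (mult w)) => h; first exact: leq_addl.
  by rewrite addn0 ltnW.
rewrite big_split /= leq_add//.
  by rewrite sum_nat_const mulnC leq_mul2l card_good_pairs orbT.
rewrite (partition_big (fun w => cls t (ratio w)) D) /=; last first.
  move=> w /ratio_neq[r0 r1]; rewrite /D /cls /= !expf_neq0//.
  by rewrite subr_eq0.
have Mc c : (M c ^ 3 <= N c ^ 3 + N (cls_swap c) ^ 3)%N.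
  by rewrite /M; case: (leqP (N c)) => _; rewrite ?leq_addl ?leq_addr.
apply: (@leq_trans (\sum_(c | D c) (g c + g (cls_swap c)))%N).
  apply: leq_sum => c Dc.
  apply: (@leq_trans (\sum_(w in [set w in good_pairs | cls t (ratio w) == c])
       (if H <= M c then M c else 0))%N).
    rewrite big_mkcond [leqRHS]big_mkcond; apply: leq_sum => w _.
    rewrite in_set; case: (w \in good_pairs) => //=.
    by case: eqP => // e; rewrite /mult e -/(M c).
  rewrite sum_nat_const; apply: (leq_trans (leq_mul (cls_fiber c) (leqnn _))).
  rewrite -!/(N _) /g /M.
  case: (leqP (N c) (N (cls_swap c))) => h.
    case: (leqP H (N (cls_swap c))) => h'; last by rewrite muln0.
    rewrite (leq_trans _ (leq_addl _ _))//.
    by rewrite expnSr -mulnn !leq_mul.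
  case: (leqP H (N c)) => h'; last by rewrite muln0.
  rewrite (leq_trans _ (leq_addr _ _))//.
  by rewrite expnSr -mulnn !leq_mul// ltnW.
rewrite big_split /= KE mul2n -addnn leq_add//.
  by rewrite big_mkcond; apply: leq_sum => c _; case: ifP.
rewrite -(big_imset g cls_swap_inj) /= big_mkcond; apply: leq_sum => c _.
by case: ifP.
Qed.

(** If x^t = (x - 1)^t then x / (x - 1) lies in R, and it determines x. *)
Lemma sum_diag_clsN : (\sum_(u : F) clsN t (u, u) <= t)%N.
Proof.
pose T : {set F * F} := [set (u, u) | u : F].
have -> : (\sum_(u : F) clsN t (u, u) = \sum_(c in T) clsN t c)%N.
  rewrite big_imset /=; first by apply: eq_bigl.
  by move=> u v _ _ [].
rewrite -card_cls_preim -[leqRHS]card_mroots.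
rewrite -(@card_in_imset _ _ (fun x => x / (x - 1))); last first.
  move=> x y; rewrite !in_set => /and3P[_ x1 _] /and3P[_ y1 _].
  rewrite -subr_eq0 in x1; rewrite -subr_eq0 in y1 => e.
  have : x * (y - 1) = y * (x - 1).
    by apply/eqP; rewrite -eqr_div // e.
  by rewrite !mulrBr !mulr1 [y * x]mulrC => /addrI/oppr_inj ->.
apply: subset_leq_card; apply/subsetP => z /imsetP[x].
rewrite in_set => /and3P[x0 x1 /imsetP[u _ [h1 h2]]] ->.
rewrite in_set exprMn exprVn h1 h2 divff// -h2 expf_neq0//.
by rewrite subr_eq0.
Qed.

Lemma sum_diag_cube H :
  (\sum_(u : F) clsN t (u, u) ^ 3 <= cube_above H + H ^ 2 * t)%N.
Proof.
apply: (@leq_trans (\sum_(u : F) ((if H <= clsN t (u, u) then clsN t (u, u) ^ 3 else 0)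
    + H ^ 2 * clsN t (u, u)))%N).
  apply: leq_sum => u _; case: (leqP H (clsN t (u, u))) => h; first exact: leq_addr.
  by rewrite add0n expnSr leq_mul2r leq_exp2r// ltnW ?orbT.
rewrite big_split /= leq_add//; last first.
  by rewrite -big_distrr leq_mul2l sum_diag_clsN orbT.
rewrite /cube_above [leqRHS]big_mkcond.
pose g (c : F * F) := (if H <= clsN t c then clsN t c ^ 3 else 0)%N.
have ui : {in F &, injective (fun u : F => (u, u))} by move=> u v _ _ [].
rewrite -(big_imset g ui) /= big_mkcond; apply: leq_sum => c _.
by case: ifP.
Qed.

(** S without 0 is a union of cosets of R, and x^t labels the coset of x. *)
Definition msum_classes : {set F} := [set x ^+ t | x in msum :\ 0].

Lemma card_msum_classes : (t * #|msum_classes| <= #|msum|)%N.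
Proof.
apply: (@leq_trans #|msum :\ 0|); last by rewrite subset_leq_card ?subD1set.
rewrite mulnC -sum_nat_const.
rewrite -[leqRHS]sum1_card.
rewrite [leqRHS](partition_big (fun x : F => x ^+ t) (mem msum_classes)) /=; last first.
  by move=> x xS; apply/imsetP; exists x.
apply: leq_sum => a /imsetP[x]; rewrite in_setD1 => /andP[x0 xS] ->.
rewrite -[leqLHS]card_mroots -(card_imset _ (mulfI x0)) sum1_card.
apply: subset_leq_card; apply/subsetP => _ /imsetP[r rR ->].
move: xS => /imset2P[y z yR zR ->] in x0 *.
rewrite unfold_in /= in_setD1 mulf_neq0// ?mroots_neq0//=.
move: (rR); rewrite in_set => /eqP r1; rewrite exprMn r1 mulr1 eqxx andbT.
apply/imset2P; exists (y * r) (z * r); last by rewrite mulrDl.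
  by move: yR; rewrite !in_set exprMn r1 mulr1.
by move: zR; rewrite !in_set exprMn r1 mulr1.
Qed.

(** Sort the pairs by the cosets (a, b, c) of 1 + y, 1 + z and y - z. On a fibre both [rep] and
    [mult] are constant, and the fibre has at most [mult]^2 elements, so only N(c^-1, c^-1)^3
    survives; a and b range over [msum_classes]. *)
Lemma sum_rep_mult (K : realFieldType) :
  \sum_(w in good_pairs) (rep (w.1 - w.2))%:R ^+ 3 / (mult w)%:R ^+ 2 <=
  (#|msum_classes| ^ 2 * \sum_(u : F) clsN t (u, u) ^ 3)%:R :> K.
Proof.
pose kap (w : F * F) := ((1 + w.1) ^+ t, (1 + w.2) ^+ t, (w.1 - w.2) ^+ t).
pose Q := setX (setX msum_classes msum_classes) [set: F].
have cl y : y \in mroots -> 1 + y != 0 -> (1 + y) ^+ t \in msum_classes.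
  move=> yR y0; apply/imsetP; exists (1 + y) => //; rewrite in_setD1 y0 /=.
  by apply/imset2P; exists 1 y => //; rewrite in_set expr1n.
rewrite (partition_big kap (mem Q)) /=; last first.
  move=> w /good_pairsP[w1 w2 h1 h2 _]; rewrite !in_setX in_setT andbT.
  by rewrite !cl.
apply: (@le_trans _ _ (\sum_(c in Q) ((clsN t (c.2^-1, c.2^-1)) ^ 3)%:R)).
  apply: ler_sum => -[[a b] c] _ /=.
  pose e := (a / b, c / b); pose m := maxn (clsN t e) (clsN t (cls_swap e)).
  set n := clsN t _.
  have -> : \sum_(w in good_pairs | kap w == (a, b, c))
     (rep (w.1 - w.2))%:R ^+ 3 / (mult w)%:R ^+ 2 =
     \sum_(w in good_pairs | kap w == (a, b, c)) n%:R ^+ 3 / m%:R ^+ 2 :> K.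
    apply: eq_bigr => w /andP[wg /eqP[h1 h2 h3]].
    have [_ _ _ _ ne] := good_pairsP wg.
    by rewrite rep_clsN ?subr_eq0// h3 /mult cls_ratio// h1 h2 h3.
  rewrite sumr_const natrX -mulrnAr; apply: ler_piMr; first by rewrite exprn_ge0.
  rewrite -[_ *+ _]mulr_natr mulrC.
  (* For m = 0 the quotient is 0, the inverse of 0 being 0 by convention. *)
  have [->|m0] := eqVneq m 0%N; first by rewrite expr0n /= invr0 mulr0.
  rewrite ler_pdivrMr ?exprn_gt0 ?ltr0n ?lt0n// mul1r -natrX ler_nat.
  apply: leq_trans (_ : clsN t e * clsN t (cls_swap e) <= _)%N; last first.
    by rewrite -mulnn leq_mul ?leq_maxl ?leq_maxr.
  apply: leq_trans (cls_fiber e); apply: subset_leq_card.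
  apply/subsetP => w; rewrite unfold_in /= => /andP[wg /eqP[h1 h2 h3]].
  by rewrite in_set wg cls_ratio// h1 h2 h3 /=.
rewrite -natr_sum ler_nat.
have -> : (\sum_(u in Q) clsN t (u.2^-1, u.2^-1) ^ 3 =
  \sum_(ab in setX msum_classes msum_classes) \sum_(c : F) clsN t (c^-1, c^-1) ^ 3)%N.
  rewrite pair_big_dep /=; apply: eq_bigl => -[ab c] /=.
  by rewrite !in_setX in_setT !andbT.
rewrite sum_nat_const cardsX mulnn leq_mul2l; apply/orP; right.
by rewrite [leqRHS](reindex_inj invr_inj).
Qed.

Lemma rep_cube H :
  ((\sum_(w in good_pairs) rep (w.1 - w.2)%R) ^ 3 <=
   (H * t ^ 2 + 2 * cube_above H) ^ 2 *
   (#|msum_classes| ^ 2 * (cube_above H + H ^ 2 * t)))%N.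
Proof.
rewrite -(ler_nat rat) natrX natr_sum.
apply: le_trans (holder_cube _ (m := fun w => (mult w)%:R) _) _ => //.
  by move=> w /mult_gt0; rewrite ltr0n.
rewrite natrM; apply: ler_pM; rewrite ?sqr_ge0//.
- by apply: sumr_ge0 => w _; rewrite divr_ge0 ?exprn_ge0.
- by rewrite -natr_sum -natrX ler_nat leq_exp2r// sum_mult.
- apply: le_trans (sum_rep_mult _) _; rewrite ler_nat leq_mul2l.
  by rewrite sum_diag_cube orbT.
Qed.

(** The excluded pairs lie on the lines y = -1, z = -1 and y = z; each line carries at most t pairs,
    of weight at most t. *)
Lemma energy_good_pairs :
  (energy <= 3 * t ^ 2 + \sum_(w in good_pairs) rep (w.1 - w.2)%R)%N.
Proof.
rewrite energy_pairs pair_big /=.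
pose bad (f : F -> F * F) := [set f z | z in mroots].
have small f : (\sum_(w in bad f) rep (w.1 - w.2)%R <= t ^ 2)%N.
  apply: (@leq_trans (\sum_(w in bad f) t)%N).
    by apply: leq_sum => w _; exact: rep_le.
  rewrite sum_nat_const -mulnn leq_mul2r -[leqRHS]card_mroots.
  by rewrite leq_imset_card orbT.
have := small (fun z => (z, z)); have := small (fun z => (z, -1)).
have := small (fun z => (-1, z)).
set b1 := bad _; set b2 := bad _; set b3 := bad _ => h1 h2 h3.
apply: (@leq_trans ((\sum_(w in b1) rep (w.1 - w.2)%R +
    \sum_(w in b2) rep (w.1 - w.2)%R + \sum_(w in b3) rep (w.1 - w.2)%R) +
    \sum_(w in good_pairs) rep (w.1 - w.2)%R)%N); last by rewrite leq_add2r; lia.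
rewrite !(big_mkcond (fun w => w \in _)) -!big_split [leqLHS]big_mkcond /=.
apply: leq_sum => -[y z] _ /=; case: ifP => // /andP[yR zR].
rewrite [_ \in good_pairs]in_set /= yR zR /=.
have [y1|y1] /= := eqVneq (1 + y) 0.
  have -> : (y, z) \in b1.
    by apply/imsetP; exists z => //; congr pair; apply/eqP; rewrite -addr_eq0 addrC y1.
  lia.
have [z1|z1] /= := eqVneq (1 + z) 0.
  have -> : (y, z) \in b2.
    by apply/imsetP; exists y => //; congr pair; apply/eqP; rewrite -addr_eq0 addrC z1.
  lia.
have [yz|yz] /= := eqVneq y z.
  have -> : (y, z) \in b3 by apply/imsetP; exists y => //; rewrite yz.
  lia.
lia.
Qed.

Lemma card_msum_ge : (t <= #|msum|)%N.
Proof.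
rewrite -[leqLHS]card_mroots -(card_imset _ (addrI 1)); apply: subset_leq_card.
apply/subsetP => _ /imsetP[x xR ->]; apply/imset2P; exists 1 x => //.
by rewrite inE expr1n.
Qed.

(** Apply [rep_cube] with H = l A0. The inequality t s <= |S|, with s the number of cosets in S,
    turns t^6 s^2 into t^4 |S|^2, and |S| >= t absorbs the excluded pairs. The constant is 180 = 4
    (27 + 18). *)
Theorem energy_cube_le (l C A0 L : nat) :
  (l <= C)%N -> (l ^ 2 <= C)%N -> (0 < C)%N ->
  (0 < A0)%N -> (A0 <= t)%N -> (0 < L)%N ->
  (cube_above (l * A0) <= L * (C * t ^ 2))%N ->
  (energy ^ 3 <= 180 * C ^ 3 * (L * A0) ^ 3 * (t ^ 4 * #|msum| ^ 2))%N.
Proof.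
move=> C1 C2 C0 A00 A0t L0 hK.
set S := #|msum|; set s := #|msum_classes|.
have sS : (t * s <= S)%N := card_msum_classes.
have tS : (t <= S)%N := card_msum_ge.
pose Z := (\sum_(w in good_pairs) rep (w.1 - w.2)%R)%N.
pose LA := (L * A0)%N.
have LL : (L <= LA)%N by rewrite leq_pmulr.
have LA0 : (A0 <= LA)%N by rewrite leq_pmull.
have h1 : (l * A0 * t ^ 2 + 2 * cube_above (l * A0) <= 3 * (C * LA * t ^ 2))%N.
  have : (l * A0 * t ^ 2 <= C * LA * t ^ 2)%N by rewrite leq_mul2r leq_mul ?orbT.
  have : (L * (C * t ^ 2) <= C * LA * t ^ 2)%N.
    by rewrite mulnA [(L * C)%N]mulnC leq_mul2r leq_mul ?orbT.
  lia.
have h2 : (cube_above (l * A0) + (l * A0) ^ 2 * t <= 2 * (C * LA * t ^ 2))%N.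
  have : ((l * A0) ^ 2 * t <= C * LA * t ^ 2)%N.
    have -> : ((l * A0) ^ 2 * t = l ^ 2 * A0 * (A0 * t))%N by ring.
    by rewrite !leq_mul// -mulnn leq_mul2r A0t orbT.
  have : (L * (C * t ^ 2) <= C * LA * t ^ 2)%N.
    by rewrite mulnA [(L * C)%N]mulnC leq_mul2r leq_mul ?orbT.
  lia.
have hZ : (Z ^ 3 <= 18 * (C * LA) ^ 3 * (t ^ 4 * S ^ 2))%N.
  apply: leq_trans (rep_cube (l * A0)) _; rewrite -/s.
  apply: (@leq_trans ((3 * (C * LA * t ^ 2)) ^ 2 * (s ^ 2 * (2 * (C * LA * t ^ 2))))%N).
    by rewrite leq_mul ?leq_exp2r// leq_mul.
  have -> : ((3 * (C * LA * t ^ 2)) ^ 2 * (s ^ 2 * (2 * (C * LA * t ^ 2))) =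
      18 * (C * LA) ^ 3 * (t ^ 4 * (t * s) ^ 2))%N by ring.
  by rewrite !leq_mul ?leq_exp2r.
have ht : ((3 * t ^ 2) ^ 3 <= 27 * (C * LA) ^ 3 * (t ^ 4 * S ^ 2))%N.
  have -> : ((3 * t ^ 2) ^ 3 = 27 * 1 * (t ^ 4 * t ^ 2))%N by ring.
  by rewrite !leq_mul ?leq_exp2r ?expn_gt0 ?muln_gt0 ?C0 ?L0 ?A00.
apply: leq_trans (_ : (3 * t ^ 2 + Z) ^ 3 <= _)%N.
  by rewrite leq_exp2r// energy_good_pairs.
apply: leq_trans (expn3_add_le _ _) _; rewrite -/LA.
have -> : (180 * C ^ 3 * LA ^ 3 * (t ^ 4 * S ^ 2) =
  4 * (27 * (C * LA) ^ 3 * (t ^ 4 * S ^ 2) + 18 * (C * LA) ^ 3 * (t ^ 4 * S ^ 2)))%N.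
  by rewrite (expnMn C LA 3); move: (C ^ 3)%N (LA ^ 3)%N (t ^ 4 * _)%N; lia.
by rewrite leq_mul2l leq_add.
Qed.

End EnergySumset.

(** * Fourier analysis *)

Section Fourier.
Variables (F : finFieldType) (chi : F -> algC).
Hypothesis chiD : forall x y, chi (x + y) = chi x * chi y.
Hypothesis chi_norm : forall x, `|chi x| = 1.
Hypothesis chi_sum : forall x, x != 0 -> \sum_xi chi (xi * x) = 0.

Lemma chi0 : chi 0 = 1.
Proof.
have h := chiD 0 0; rewrite addr0 in h.
have n0 : chi 0 != 0 by rewrite -normr_eq0 chi_norm oner_eq0.
by apply: (mulfI n0); rewrite -h mulr1.
Qed.

Lemma chi_conj x : (chi x)^* = chi (- x).
Proof.
have n0 : chi x != 0 by rewrite -normr_eq0 chi_norm oner_eq0.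
by apply: (mulfI n0); rewrite -normCK chi_norm -chiD subrr chi0 expr1n.
Qed.

Lemma chi_orth x : \sum_xi chi (xi * x) = #|F|%:R * (x == 0)%:R.
Proof.
have [->|/chi_sum ->] := eqVneq x 0; last by rewrite mulr0.
under eq_bigr do rewrite mulr0 chi0.
by rewrite sumr_const mulr1 cardE.
Qed.

Definition four (f : F -> algC) (xi : F) : algC := \sum_x f x * chi (xi * x).

Lemma plancherel f : \sum_xi `|four f xi| ^+ 2 = #|F|%:R * \sum_x `|f x| ^+ 2.
Proof.
have E xi : `|four f xi| ^+ 2 =
    \sum_x \sum_y f x * (f y)^* * chi (xi * (x - y)).
  rewrite normCK /four rmorph_sum big_distrlr /=.
  apply: eq_bigr => x _; apply: eq_bigr => y _.
  by rewrite rmorphM /= chi_conj mulrBr chiD; ring.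
under eq_bigr do rewrite E.
rewrite exchange_big /= mulr_sumr; apply: eq_bigr => x _.
rewrite exchange_big /= (bigD1 x) //= [X in _ + X]big1 ?addr0.
  by rewrite -mulr_sumr subrr chi_orth eqxx mulr1 normCK mulrC.
move=> y yx; rewrite -mulr_sumr chi_orth subr_eq0 eq_sym (negPf yx).
by rewrite !mulr0.
Qed.

Definition ind (A : {set F}) (x : F) : algC := (x \in A)%:R.

Lemma four_ind A xi : four (ind A) xi = \sum_(x in A) chi (xi * x).
Proof.
rewrite /four [RHS]big_mkcond; apply: eq_bigr => x _; rewrite /ind.
by case: (x \in A); rewrite ?mul1r ?mul0r.
Qed.

Lemma four_ind0 A : four (ind A) 0 = #|A|%:R.
Proof.
rewrite four_ind; under eq_bigr do rewrite mul0r chi0.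
by rewrite sumr_const.
Qed.

Lemma plancherel_ind A : \sum_xi `|four (ind A) xi| ^+ 2 = #|F|%:R * #|A|%:R.
Proof.
rewrite plancherel; congr (_ * _).
rewrite -sum1_card natr_sum [RHS]big_mkcond; apply: eq_bigr => x _.
by rewrite /ind; case: (x \in A); rewrite ?normr1 ?normr0 ?expr1n ?expr0n.
Qed.

(** * Fourier coefficients of R and of R + R *)

Section MRoots.
Variable t : nat.
Local Notation R := (mroots F t).
Local Notation S := (msum F t).
Hypotheses (t_gt0 : (0 < t)%N) (card_R : #|R| = t).

Lemma four_rep xi : four (fun d => (rep t d)%:R) xi = `|four (ind R) xi| ^+ 2.
Proof.
rewrite normCK !four_ind rmorph_sum big_distrlr /=.
under [RHS]eq_bigr do under eq_bigr do rewrite chi_conj -chiD -mulrBr.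
rewrite pair_big /= (partition_big (fun w => w.1 - w.2) predT) //=.
apply: eq_bigr => d _.
rewrite (eq_bigr (fun=> chi (xi * d))); last by move=> w /andP[_ /eqP ->].
rewrite sumr_const -[RHS]mulr_natl; congr (_%:R * _).
rewrite /rep; have fi : injective (fun y => (y, y - d)) by move=> y z [].
rewrite -(card_imset _ fi); apply: eq_card => -[y z].
rewrite [RHS]unfold_in /=; apply/imsetP/andP.
  move=> [y']; rewrite in_set => /andP[h1 h2] [-> ->]; rewrite h1 h2; split=> //.
  by apply/eqP; ring.
move=> [/andP[yR zR] /eqP <-]; exists y; last by congr pair; ring.
by rewrite in_set yR; have -> : y - (y - z) = z by ring.
Qed.

Lemma fourth_moment : \sum_xi `|four (ind R) xi| ^+ 4 = #|F|%:R * (energy F t)%:R.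
Proof.
under eq_bigr => xi _.
  rewrite (exprM _ 2 2) -four_rep.
  rewrite -[four _ _]ger0_norm; last by rewrite four_rep exprn_ge0.
  over.
rewrite plancherel; congr (_ * _); rewrite /energy natr_sum.
by apply: eq_bigr => d _; rewrite ger0_norm ?natrX.
Qed.

Lemma four_inv xi r : r \in R -> four (ind R) (xi * r) = four (ind R) xi.
Proof.
move=> rR; have r0 := mroots_neq0 t_gt0 rR.
rewrite /four [RHS](reindex_inj (mulfI r0)) /=; apply: eq_bigr => x _.
rewrite mulrA; congr (_ * _); rewrite /ind !inE exprMn.
by move: rR; rewrite inE => /eqP ->; rewrite mul1r.
Qed.

Lemma four_bound xi : xi != 0 ->
  t%:R * `|four (ind R) xi| ^+ 4 <= #|F|%:R * (energy F t)%:R.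
Proof.
move=> xi0; rewrite -fourth_moment.
have -> : t%:R * `|four (ind R) xi| ^+ 4 =
   \sum_(e in [set xi * r | r in R]) `|four (ind R) e| ^+ 4.
  rewrite big_imset /=; last by move=> x y _ _; apply: mulfI.
  under eq_bigr => r rR do rewrite four_inv//.
  by rewrite sumr_const card_R mulr_natl.
rewrite [leLHS]big_mkcond; apply: ler_sum => e _.
by case: ifP => // _; rewrite exprn_ge0.
Qed.

(** By orthogonality the sum is |F| times the number of solutions of s1 + s2 + r1 + r2 = lam r. *)
Lemma no_solution_sum lam :
  (forall s1 s2 r1 r2 r, s1 \in S -> s2 \in S -> r1 \in R -> r2 \in R ->
     r \in R -> s1 + s2 + r1 + r2 != lam * r) ->
  \sum_xi four (ind S) xi ^+ 2 * four (ind R) xi ^+ 2 * four (ind R) (- lam * xi) = 0.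
Proof.
move=> no.
have E xi : four (ind S) xi ^+ 2 * four (ind R) xi ^+ 2 * four (ind R) (- lam * xi)
  = \sum_(s1 in S) \sum_(s2 in S) \sum_(r1 in R) \sum_(r2 in R) \sum_(r in R)
     chi (xi * (s1 + s2 + r1 + r2 - lam * r)).
  rewrite !expr2 !four_ind -!mulrA mulr_suml; apply: eq_bigr => s1 _.
  rewrite mulr_suml mulr_sumr; apply: eq_bigr => s2 _.
  rewrite mulr_suml 2!mulr_sumr; apply: eq_bigr => r1 _.
  rewrite mulr_suml 3!mulr_sumr; apply: eq_bigr => r2 _.
  rewrite !mulr_sumr; apply: eq_bigr => r _.
  rewrite -!chiD; congr chi; ring.
under eq_bigr do rewrite E.
rewrite exchange_big big1 //= => s1 h1.
rewrite exchange_big big1 //= => s2 h2.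
rewrite exchange_big big1 //= => r1 h3.
rewrite exchange_big big1 //= => r2 h4.
rewrite exchange_big big1 //= => r h5.
by rewrite chi_sum// subr_eq0 no.
Qed.

Lemma no_solution_bound lam : lam != 0 ->
  (forall s1 s2 r1 r2 r, s1 \in S -> s2 \in S -> r1 \in R -> r2 \in R ->
     r \in R -> s1 + s2 + r1 + r2 != lam * r) ->
  (t ^ 3 * (#|S| * t ^ 3) ^ 4 <= #|F| ^ 7 * energy F t ^ 3)%N.
Proof.
move=> lam0 /no_solution_sum.
set q := #|F|; set E := energy F t.
(* The value for which the bound of [four_bound] becomes the equality t rho^4 = q E. *)
pose rho : algC := 4.-root (q%:R * E%:R / t%:R).
have t0 : t%:R != 0 :> algC by rewrite pnatr_eq0 -lt0n.
have rho0 : 0 <= rho by rewrite rootC_ge0// divr_ge0 ?mulr_ge0.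
have rho4 : t%:R * rho ^+ 4 = q%:R * E%:R.
  by rewrite /rho rootCK// mulrC divfK.
have le_rho xi : xi != 0 -> `|four (ind R) xi| <= rho.
  move=> xi0; rewrite -(@ler_pXn2r _ 4) ?nnegrE//.
  rewrite -(@ler_pM2l _ t%:R) ?ltr0n// rho4.
  exact: four_bound.
(* The zero frequency contributes |S|^2 t^3 and must be cancelled by the others, whose total is at
   most rho^3 times the Plancherel sum q |S|. *)
rewrite (bigD1 0) //= mulr0 !four_ind0 card_R => /eqP.
rewrite addr_eq0 => /eqP h.
have S0 : (0 < #|S|)%N by apply: leq_trans t_gt0 (card_msum_ge _).
have h2 : (#|S| * t ^ 3)%:R <= q%:R * rho ^+ 3 :> algC.
  have Sp : 0 < #|S|%:R :> algC by rewrite ltr0n.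
  rewrite -(@ler_pM2l _ _ Sp).
  have -> : #|S|%:R * (#|S| * t ^ 3)%:R = #|S|%:R ^+ 2 * t%:R ^+ 2 * t%:R :> algC.
    by rewrite natrM natrX; ring.
  rewrite -[leLHS]ger0_norm ?mulr_ge0 ?exprn_ge0// h normrN.
  apply: le_trans (ler_norm_sum _ _ _) _.
  have -> : #|S|%:R * (q%:R * rho ^+ 3) = (q%:R * #|S|%:R) * rho ^+ 3 by ring.
  rewrite -plancherel_ind mulr_suml [leRHS](bigD1 0) //=.
  apply: le_trans (_ : \sum_(i | i != 0) `|four (ind S) i| ^+ 2 * rho ^+ 3 <= _); last first.
    by rewrite lerDr mulr_ge0 ?exprn_ge0.
  apply: ler_sum => xi xi0; rewrite 2!normrM 2!normrX -mulrA.
  apply: ler_wpM2l; first by rewrite exprn_ge0.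
  rewrite (exprSr rho 2); apply: ler_pM; rewrite ?exprn_ge0//.
    by rewrite lerXn2r ?nnegrE// le_rho.
  by rewrite le_rho// mulf_neq0// oppr_eq0.
(* The fourth power produces rho^12 = (rho^4)^3, so the factor t^3 eliminates rho and leaves an
   inequality between natural numbers. *)
rewrite -(ler_nat algC) natrM [X in _ * X]natrX.
have -> : (q ^ 7 * E ^ 3)%:R = (t ^ 3)%:R * (q%:R * rho ^+ 3) ^+ 4 :> algC.
  rewrite natrM !natrX.
  have -> : t%:R ^+ 3 * (q%:R * rho ^+ 3) ^+ 4 = q%:R ^+ 4 * (t%:R * rho ^+ 4) ^+ 3 by ring.
  by rewrite rho4; ring.
apply: ler_wpM2l => //; rewrite lerXn2r ?nnegrE ?mulr_ge0 ?exprn_ge0//.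
Qed.

Definition addrep (x : F) : nat := #|[set w in setX R R | w.1 + w.2 == x]|.

Lemma four_addrep xi : four (fun x => (addrep x)%:R) xi = four (ind R) xi ^+ 2.
Proof.
rewrite expr2 !four_ind big_distrlr /=.
under [RHS]eq_bigr do under eq_bigr do rewrite -chiD -mulrDr.
rewrite pair_big /= (partition_big (fun w => w.1 + w.2) predT) //=.
apply: eq_bigr => d _.
rewrite (eq_bigr (fun=> chi (xi * d))); last by move=> w /andP[_ /eqP ->].
rewrite sumr_const -[RHS]mulr_natl; congr (_%:R * _).
apply: eq_card => -[y z]; rewrite [RHS]unfold_in /= in_set in_setX //=.
Qed.

(** Sums and differences have the same energy: by Plancherel both equal the fourth moment of the
    transform of R divided by |F|. *)
Lemma energy_addrep : (\sum_x addrep x ^ 2 = energy F t)%N.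
Proof.
have F0 : #|F|%:R != 0 :> algC by rewrite pnatr_eq0 -lt0n; apply/card_gt0P; exists 0.
apply/eqP; rewrite -(eqr_nat algC); apply/eqP; apply: (mulfI F0).
rewrite -fourth_moment natr_sum.
have := plancherel (fun x => (addrep x)%:R).
under [X in _ = _ * X]eq_bigr do rewrite ger0_norm// -natrX.
move=> <-; apply: eq_bigr => xi _; rewrite four_addrep normrX -exprM//.
Qed.

Lemma energy_msum : (t ^ 4 <= #|S| * energy F t)%N.
Proof.
have h : (\sum_(x in S) addrep x = t ^ 2)%N.
  transitivity #|setX R R|; last by rewrite cardsX card_R mulnn.
  rewrite -[RHS]sum1_card (partition_big (fun w => w.1 + w.2) (mem S)) /=; last first.
    by move=> -[y z]; rewrite in_setX => /andP[yR zR]; apply/imset2P; exists y z.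
  apply: eq_bigr => x _; rewrite /addrep -sum1_card; apply: eq_bigl => w.
  by rewrite in_set.
apply: (@leq_trans (#|S| * \sum_(x in S) addrep x ^ 2)%N); last first.
  rewrite leq_mul2l -energy_addrep [leqLHS]big_mkcond; apply/orP; right.
  by apply: leq_sum => x _; case: ifP.
have S0 : (0 < #|S|)%N by apply: leq_trans t_gt0 (card_msum_ge _).
rewrite (expnM _ 2 2) -h; set T := (\sum_(x in S) addrep x)%N.
rewrite -(ler_nat rat) natrM natrX natr_sum.
under [X in _ * X]eq_bigr do rewrite natrX.
(* Cauchy-Schwarz on S, obtained by expanding a sum of squared deviations from the mean. *)
have : 0 <= \sum_(x in S) (#|S|%:R * (addrep x)%:R - T%:R) ^+ 2 :> rat.
  by apply: sumr_ge0 => x _; rewrite sqr_ge0.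
have -> : \sum_(x in S) (#|S|%:R * (addrep x)%:R - T%:R) ^+ 2 =
   #|S|%:R * (#|S|%:R * \sum_(x in S) (addrep x)%:R ^+ 2 - T%:R ^+ 2) :> rat.
  under eq_bigr do rewrite sqrrB exprMn.
  rewrite big_split sumrB /= sumr_const sumrMnl -!mulr_suml -!mulr_sumr -natr_sum -/T.
  rewrite -mulr_natl; ring.
by rewrite pmulr_rge0 ?ltr0n// subr_ge0.
Qed.

End MRoots.
End Fourier.

Lemma energy_le (F : finFieldType) t : #|mroots F t| = t -> (energy F t <= t ^ 3)%N.
Proof.
move=> cR; rewrite energy_pairs.
apply: (@leq_trans (\sum_(y in mroots F t) \sum_(z in mroots F t) t)%N).
  by apply: leq_sum => y _; apply: leq_sum => z _; exact: rep_le.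
by rewrite !sum_nat_const cR !expnS expn0 muln1.
Qed.

(** * Prime fields: additive characters, and subgroups as roots of unity *)

Lemma Fp_natr_neq0 p k : prime p -> (0 < k < p)%N -> k%:R != 0 :> 'F_p.
Proof.
move=> pp /andP[k0 kp]; rewrite -(dvdn_pcharf (pchar_Fp pp)).
by apply/negP => /(dvdn_leq k0); rewrite leqNgt kp.
Qed.

Lemma exists_Fp_character p : prime p -> exists chi : 'F_p -> algC,
  [/\ forall x y, chi (x + y) = chi x * chi y, forall x, `|chi x| = 1
    & forall x, x != 0 -> \sum_xi chi (xi * x) = 0].
Proof.
move=> pp; have [z zp] := C_prim_root_exists (prime_gt0 pp).
pose chi (x : 'F_p) : algC := z ^+ (x : nat).
have zF : (Zp_trunc (pdiv p)).+2.-primitive_root z by rewrite Fp_cast.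
have chiD x y : chi (x + y) = chi x * chi y.
  by rewrite /chi -exprD /= (prim_expr_mod zF).
exists chi; split => // [x|x x0].
  rewrite /chi normrX; suff -> : `|z| = 1 by rewrite expr1n.
  apply/eqP; rewrite -(@pexpr_eq1 _ _ p) ?prime_gt0// -normrX.
  by rewrite (prim_expr_order zp) normr1.
have chi1 : chi 1 != 1.
  rewrite /chi /= modn_small ?expr1//.
  rewrite -(expr1 z) -(prim_order_dvd zp) dvdn1.
  by apply/eqP => p1; rewrite p1 in pp.
set T := \sum_xi _.
have : T = T * chi 1.
  (* Translating xi by 1 / x multiplies the sum by chi(1), which is not 1. *)
  rewrite {1}/T (reindex_inj (addIr x^-1)) /= mulr_suml; apply: eq_bigr => xi _.
  by rewrite mulrDl mulVf// chiD.
move/eqP; rewrite -{1}[T]mulr1 -subr_eq0 -mulrBr mulf_eq0 subr_eq0 eq_sym.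
by rewrite [1 == _]eq_sym (negPf chi1) orbF => /eqP.
Qed.

(** Elements of G are roots of X^|G| - 1 by Lagrange, and this polynomial has no more than |G|
    roots. *)
Lemma mroots_group (F : finFieldType) (G : {group {unit F}}) :
  mroots F #|G| = [set val g | g in G].
Proof.
apply/eqP; rewrite eq_sym eqEcard; apply/andP; split.
  apply/subsetP => _ /imsetP[g gG ->].
  by rewrite inE -FinRing.val_unitX cyclic.expg_cardG.
rewrite card_imset; last exact: val_inj.
rewrite cardE; apply: max_unity_roots; rewrite ?enum_uniq//.
by apply/allP => x; rewrite mem_enum inE unity_rootE.
Qed.

Lemma card_mroots_group (F : finFieldType) (G : {group {unit F}}) :
  #|mroots F #|G| | = #|G|.
Proof. by rewrite mroots_group card_imset//; exact: val_inj. Qed.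

(** Dividing a solution by r, and splitting each s into two elements of G, would write x as a sum of
    six elements of G. *)
Lemma sum_six_group (p : nat) (G : {group {unit 'F_p}}) (x : 'F_p) :
  ~ in_sumset 6 G x ->
  forall s1 s2 r1 r2 r, s1 \in msum 'F_p #|G| -> s2 \in msum 'F_p #|G| ->
    r1 \in mroots 'F_p #|G| -> r2 \in mroots 'F_p #|G| ->
    r \in mroots 'F_p #|G| -> s1 + s2 + r1 + r2 != x * r.
Proof.
rewrite /msum mroots_group => no s1 s2 r1 r2 r.
move=> /imset2P[_ _ /imsetP[a aG ->] /imsetP[b bG ->] ->].
move=> /imset2P[_ _ /imsetP[c cG ->] /imsetP[d dG ->] ->].
move=> /imsetP[e eG ->] /imsetP[f fG ->] /imsetP[g gG ->].
apply/eqP => E; apply: no.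
pose h (i : 'I_6) : {unit 'F_p} := (nth 1 [:: a; b; c; d; e; f] i * g^-1)%g.
exists h; split.
  by case; do 6!(case=> [? | ]; first by rewrite /h /= groupM ?groupV).
have g0 : val g != 0 by rewrite -unitfE; exact: valP.
rewrite !big_ord_recl big_ord0 /h /= addr0.
apply: (mulIf g0); rewrite -E !mulrDl !divfK//.
by rewrite !addrA.
Qed.

(** * The exponents *)

Close Scope ring_scope.
From Stdlib Require Import Reals Lra.

(* [Reals] rebinds the nat power to [Nat.pow]. *)
Local Notation "m ^ n" := (expn m n) : nat_scope.

Definition lnn (n : nat) : R := ln (INR n).

Lemma ln_mono (x y : R) : (0 < x)%R -> (x <= y)%R -> (ln x <= ln y)%R.
Proof.
move=> x0 [xy|->]; last exact: Rle_refl.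
by apply: Rlt_le; exact: ln_increasing.
Qed.

Lemma INR_gt0 n : (0 < n)%N -> (0 < INR n)%R.
Proof. by move=> /ssrnat.ltP; exact: lt_0_INR. Qed.

Lemma lnn_le a b : (0 < a)%N -> (a <= b)%N -> (lnn a <= lnn b)%R.
Proof. by move=> a0 /ssrnat.leP ab; apply: ln_mono; [exact: INR_gt0 | exact: le_INR]. Qed.

Lemma lnn_ge_leq a b : (0 < b)%N -> (lnn a <= lnn b)%R -> (a <= b)%N.
Proof.
move=> b0 h; rewrite leqNgt; apply/negP => ba.
have : (lnn b < lnn a)%R.
  by apply: ln_increasing; [exact: INR_gt0 | apply: lt_INR; exact/ssrnat.ltP].
lra.
Qed.

Lemma lnnM a b : (0 < a)%N -> (0 < b)%N -> lnn (a * b) = (lnn a + lnn b)%R.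
Proof. by move=> a0 b0; rewrite /lnn -multE mult_INR ln_mult//; exact: INR_gt0. Qed.

Lemma lnnX a n : (0 < a)%N -> lnn (a ^ n) = (INR n * lnn a)%R.
Proof.
move=> a0; elim: n => [|n IH]; first by rewrite expn0 /lnn /= ln_1; lra.
rewrite expnS lnnM ?expn_gt0 ?a0// IH S_INR; lra.
Qed.

Lemma lnn_le_linear n (c : R) :
  (0 < n)%N -> (0 < c)%R -> (lnn n <= c * INR n - 1 - ln c)%R.
Proof.
move=> /INR_gt0 n0 c0.
have h : (0 < c * INR n)%R by apply: Rmult_lt_0_compat.
have := exp_ineq1_le (ln (c * INR n)).
rewrite exp_ln// ln_mult// /lnn; lra.
Qed.

(** After taking logarithms all hypotheses are linear in ln p, ln t, ln S, ln E, ln L and ln A, with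
    bounded constants. *)
Lemma numeric_contradiction (kappa : R) (G : nat) :
  (41 / 83 < kappa)%R -> (0 < G)%N ->
  exists p0 : nat, forall p t S E L A : nat,
    (p0 <= p)%N -> (1 < p)%N -> (0 < t)%N -> (0 < L)%N -> (0 < A)%N ->
    (Rpower (INR p) kappa <= INR t)%R ->
    (2 ^ L.-1 <= p)%N -> (A * p <= 2 * t ^ 2 + p)%N -> (t <= S)%N ->
    (t ^ 3 * (S * t ^ 3) ^ 4 <= p ^ 7 * E ^ 3)%N ->
    (t ^ 4 <= S * E)%N -> (E <= t ^ 3)%N ->
    ((64 * A ^ 3 <= t ^ 2)%N ->
       (E ^ 3 <= G * (L * A) ^ 3 * (t ^ 4 * S ^ 2))%N) -> False.
Proof.
(* The tangent of slope 1/1000 bounds ln L by about 2 ln p / 1000, and M makes each constant less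
   than ln p / 1000. Together these stay within the gap 71 (41/83) - 35, which is about 0.07. *)
move=> hk G0; pose c := ln (1 / 1000).
pose M := (1000 * (Rabs (lnn G) + Rabs c + Rabs (lnn 3) + Rabs (lnn 64) + 1))%R.
have [p0 hp0] := INR_unbounded (exp M).
exists p0 => p t S E L A p0p p1 t0 L0 A0 pt Lp Ap tS h2 h3 h4 h5.
have p_gt0 : (0 < p)%N by apply: ltn_trans p1.
have S0 : (0 < S)%N by apply: leq_trans tS.
have E0 : (0 < E)%N.
  rewrite lt0n; apply/eqP => E0; move: h3; rewrite E0 muln0 leqn0.
  by rewrite expn_eq0 (gtn_eqF t0).
have x0 (n m : nat) : (0 < n)%N -> (0 < n ^ m)%N by move=> n0; rewrite expn_gt0 n0.
have m0 (n m : nat) : (0 < n)%N -> (0 < m)%N -> (0 < n * m)%N.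
  by move=> n0 m0; rewrite muln_gt0 n0.
have Mp : (M < lnn p)%R.
  rewrite -(ln_exp M); apply: ln_increasing; first exact: exp_pos.
  by apply: Rlt_le_trans hp0 _; apply: le_INR; exact/ssrnat.leP.
have aG := Rle_abs (lnn G); have ac := Rle_abs (- c).
have a3 := Rle_abs (lnn 3); have a64 := Rle_abs (lnn 64).
rewrite Rabs_Ropp in ac.
have bG := Rabs_pos (lnn G); have bc := Rabs_pos c.
have b3 := Rabs_pos (lnn 3); have b64 := Rabs_pos (lnn 64).
have lp0 : (0 < lnn p)%R by rewrite /M in Mp; lra.
have l1 : (41 / 83 * lnn p <= lnn t)%R.
  apply: (Rle_trans _ (kappa * lnn p)); first by apply: Rmult_le_compat_r; lra.
  rewrite -[X in (X <= _)%R]ln_exp; apply: ln_mono pt; exact: exp_pos.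
have l2 : (3 * lnn t + 4 * (lnn S + 3 * lnn t) <= 7 * lnn p + 3 * lnn E)%R.
  have := lnn_le (m0 _ _ (x0 _ 3 t0) (x0 _ 4 (m0 _ _ S0 (x0 _ 3 t0)))) h2.
  rewrite !(lnnM, lnnX); try by auto.
  by simpl INR; lra.
have l3 : (4 * lnn t <= lnn S + lnn E)%R.
  have := lnn_le (x0 t 4 t0) h3.
  rewrite !(lnnM, lnnX); try by auto.
  by simpl INR; lra.
have l4 : (lnn E <= 3 * lnn t)%R.
  have := lnn_le E0 h4.
  rewrite !(lnnM, lnnX); try by auto.
  by simpl INR; lra.
have lS := lnn_le t0 tS.
(* As ln 2 > 1/2, the bound 2^(L-1) <= p gives L <= 2 ln p + 1. *)
have lL : (lnn L <= 1 / 1000 * (2 * lnn p + 1) - 1 - c)%R.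
  have e0 : (0 < 1 / 1000)%R by lra.
  have := lnn_le_linear L0 e0; rewrite -/c.
  have := lnn_le (x0 2 L.-1 isT) Lp; rewrite lnnX //.
  have ll2 : (/ 2 < lnn 2)%R by exact: ln_lt_2.
  have -> : INR L = (INR L.-1 + 1)%R by rewrite -S_INR prednK.
  have := pos_INR L.-1; nra.
have lA : (lnn A <= lnn 3)%R \/ (lnn A + lnn p <= lnn 3 + 2 * lnn t)%R.
  have [tp|pt2] := leqP (t ^ 2) p.
    left; apply: lnn_le => //.
    rewrite -(leq_pmul2r p_gt0); apply: leq_trans Ap _.
    by rewrite [leqRHS]mulSn addnC leq_add2l leq_mul2l.
  right; have h : (A * p <= 3 * t ^ 2)%N.
    by apply: leq_trans Ap _; rewrite [leqRHS]mulSn addnC leq_add2r ltnW.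
  have := lnn_le (m0 _ _ A0 p_gt0) h.
  rewrite (lnnM A0 p_gt0) (lnnM (isT : 0 < 3)%N (x0 _ 2 t0)) (lnnX 2 t0).
  by simpl INR; lra.
(* The trivial bounds S >= t and E <= t^3 in [l2] give t^10 <= p^7. Hence t^6 / p^3, the order of
   A^3 when A is not bounded by 3, is far below t^2. *)
have A64 : (64 * A ^ 3 <= t ^ 2)%N.
  apply: lnn_ge_leq; first exact: x0.
  rewrite lnnM; try by auto.
  rewrite !lnnX; try by auto.
  simpl INR; rewrite /M in Mp; case: lA; lra.
have : (3 * lnn E <= lnn G + 3 * (lnn L + lnn A) + (4 * lnn t + 2 * lnn S))%R.
  have := lnn_le (x0 _ 3 E0) (h5 A64).
  rewrite !(lnnM, lnnX); try by auto.
  by simpl INR; lra.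
(* Eliminating S and E gives, up to the error terms, 71 ln t <= 35 ln p when A <= 3 and 29 ln t <=
   14 ln p otherwise; both contradict [l1]. *)
rewrite /M in Mp; case: lA; lra.
Qed.

Theorem theorem4p1 (kappa : R) (hk : (41 / 83 < kappa)%R) :
  exists p0 : nat, forall (p : nat), prime p -> (p0 <= p)%N ->
    forall G : {group {unit 'F_p}},
      (Rpower (INR p) kappa <= INR #|G|)%R ->
      forall x : 'F_p, x != GRing.zero -> in_sumset 6 G x.
Proof.
have C0 : (0 < lev ^ 3)%N by rewrite expn_gt0.
have G0 : (0 < 180 * (lev ^ 3) ^ 3)%N by rewrite muln_gt0 /= expn_gt0 C0.
have [p0 contra] := numeric_contradiction hk G0.
exists p0 => p pp p0p G hG x x0.
have [//|no] := Classical_Prop.classic (in_sumset 6 G x); exfalso.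
have no6 := sum_six_group no.
have [chi [chiD chiN chiS]] := exists_Fp_character pp.
pose t := #|G|; have t0 : (0 < t)%N := cardG_gt0 G.
have cR : #|mroots 'F_p t| = t := card_mroots_group G.
have cF : #|'F_p| = p := card_Fp pp.
have tp : (t <= p)%N by rewrite -cR -[leqRHS]cF max_card.
(* A satisfies 2 t^2 <= p A <= 2 t^2 + p: large enough for Stepanov's method, and of order 1 + t^2 /
   p. L is the least exponent with p < 2^L. *)
pose A := ((2 * t ^ 2) %/ p).+1; pose L := (trunc_log 2 p).+1.
have p_gt0 := prime_gt0 pp.
have /andP[Lp pL] := trunc_log_bounds (isT : 1 < 2)%N p_gt0.
apply: (contra p t #|msum 'F_p t| (energy 'F_p t) L A) => //.
- exact: prime_gt1.
- by rewrite /A mulSn addnC leq_add2r leq_trunc_div.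
- exact: card_msum_ge.
- by have := no_solution_bound chiD chiN chiS t0 cR x0 no6; rewrite cF.
- exact: (energy_msum chiD chiN chiS t0 cR).
- exact: energy_le.
move=> A64; have A0 : (0 < A)%N by [].
have C1 : (lev <= lev ^ 3)%N by rewrite -[leqLHS]expn1 leq_pexp2l.
have C2 : (lev ^ 2 <= lev ^ 3)%N by rewrite leq_pexp2l.
apply: (energy_cube_le t0 cR C1 C2 C0 A0 _ (ltn0Sn _)).
- by rewrite -leq_sqr; apply: leq_trans A64; rewrite mulnC; nia.
- have pA : (2 * t ^ 2 <= p * A)%N by rewrite [leqRHS]mulnC; exact: ltnW (ltn_ceil _ p_gt0).
  have FL : (#|'F_p| < 2 ^ L)%N by rewrite cF; exact: pL.
  exact: (sum_cube_clsN (fun k => @Fp_natr_neq0 p k pp) tp A0 pA A64 FL).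
Qed.
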